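(* There are only finitely many Keith numbers which are rep-digits, and the set of all Keith numbers which are rep-digits can be effectively determined.
   Context: Keith numbers: let $N$ be a positive integer with decimal representation $a_1a_2\ldots a_n$ (digits read from left to right, $a_1\neq 0$). Let $K^N=(K^N_m)_{m\ge 1}$ be the sequence given by $K^N_1=a_1,\dots,K^N_n=a_n$ and $K^N_m=K^N_{m-1}+K^N_{m-2}+\cdots+K^N_{m-n}$ for all $m>n$. The number $N$ is a Keith number if $n\ge 2$ and $N=K^N_m$ for some $m\ge 1$. Rep-digits: a rep-digit is a positive integer of the form $a(10^n-1)/9$ with $a\in\{1,\ldots,9\}$ and $n\ge 1$, i.e. a number whose decimal representation is a string of the same digit $a$. ''Can be effectively determined'' has its usual meaning: there is an effectively computable upper bound for the elements of the (finite) set, so that the set can in principle be listed by a finite computation. *)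

(* Defs.v *)
From mathcomp Require Import all_boot.

Set Implicit Arguments.
Unset Strict Implicit.
Unset Printing Implicit Defensive.

(* [ds] lists the digits from left to right; the second clause also forces
   [ds] to be nonempty. *)
Definition decimal_rep (N : nat) (ds : seq nat) : Prop :=
  [/\ all (fun d => d < 10) ds,
      head 0 ds != 0
    & N = \sum_(i < size ds) nth 0 ds i * 10 ^ (size ds - 1 - i)].

(* The sequence is indexed from 1, while [ds] is indexed from 0; the value
   [K 0] plays no role. *)
Definition keith_seq (ds : seq nat) (K : nat -> nat) : Prop :=
  (forall i, i < size ds -> K i.+1 = nth 0 ds i) /\
  (forall m, size ds < m -> K m = \sum_(1 <= i < (size ds).+1) K (m - i)).

Definition keith (N : nat) : Prop :=
  exists (ds : seq nat) (K : nat -> nat),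
    [/\ decimal_rep N ds, keith_seq ds K, 2 <= size ds
      & exists m, 1 <= m /\ N = K m].

(* The division by 9 is exact. *)
Definition repdigit (N : nat) : Prop :=
  exists a n : nat, [/\ 1 <= a <= 9, 1 <= n & N = a * ((10 ^ n - 1) %/ 9)].

Definition finitely_many (P : nat -> Prop) : Prop :=
  exists s : seq nat, forall N, P N -> N \in s.

(* Effectiveness is expressed by informative existentials ([sig], not [ex]):
   an inhabitant provides the upper bound and the complete list of elements as
   data. It is a computation of these data when it is constructed without
   appeal to a choice or description axiom. *)
Definition effectively_determined (P : nat -> Prop) : Type :=
  {B : nat | forall N, P N -> N <= B} *
  {s : seq nat | forall N, N \in s <-> P N}.

(* Main.v *)
Require Import Defs.
From mathcomp Require Import all_boot all_order all_algebra.
From mathcomp Require Import zify ring.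

Set Implicit Arguments.
Unset Strict Implicit.
Unset Printing Implicit Defensive.

Import Order.TTheory GRing.Theory Num.Theory.

(** There are no rep-digit Keith numbers at all, so the bound 0 and the empty
    list are the data asked for.

    Let N be the rep-digit with n >= 2 digits a.  Its Keith sequence starts with
    n copies of a, hence is a times the sequence F that starts with n ones and
    in which every term is the sum of the n preceding ones.  So N is a Keith
    number iff some F m equals the repunit (10^n - 1)/9.  This is refuted by
    2-adic considerations and a crude growth estimate.

    The sequence F satisfies F (m+n+1) = 2 F (m+n) - F m, and so does
    G = F - 1, which in addition vanishes at 1, ..., n; running the recurrence
    backwards gives G 0 = 1 - n.  Write m = j(n+1) + i with 0 <= i <= n.  By
    induction on blocks of length n+1, 2^i divides G m ([dvdz_shifted]), and
    modulo 2^(n+1) one has G m = (-1)^j (1-n) when i = 0 and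
    G m = (-1)^j 2j(1-n) when i = 1 ([shifted_block0], [shifted_block1]).

    If F m is the repunit then 9 G m + 10 = 10^n is divisible by 2^n.  Hence
    4 does not divide G m, which forces i <= 1 ([repunit_offset]).  The two
    congruences then say that 2^n divides 10 + (-1)^j 9(1-n), or that 2^(n-1)
    divides 5 + (-1)^j 9j(1-n).  Since F grows at least like (3/2)^m, the index
    j is at most 6 ([nbonacci_large]), so these numbers are linear in n and too
    small for n >= 10.  For n < 10 only a few pairs (n, j) survive, with
    n = 2, 3, 4 ([offset0_excluded], [offset1_excluded]), and there the terms
    of F are compared directly with 11, 111 and 1111. *)

(** * Decimal digits of rep-digits *)

Definition digits_value (ds : seq nat) : nat :=
  \sum_(i < size ds) nth 0 ds i * 10 ^ (size ds - 1 - i).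

Lemma digits_value_cons d ds :
  digits_value (d :: ds) = d * 10 ^ size ds + digits_value ds.
Proof.
rewrite /digits_value /= big_ord_recl /= subn1 subn0 /=; congr (_ + _).
by apply: eq_bigr => i _; congr (_ * 10 ^ _); rewrite /bump /=; lia.
Qed.

Lemma digits_value_rcons ds d :
  digits_value (rcons ds d) = 10 * digits_value ds + d.
Proof.
elim: ds => [|x ds IH].
  by rewrite digits_value_cons /digits_value !big_ord0 muln1 muln0 addn0.
by rewrite rcons_cons !digits_value_cons IH size_rcons expnS; ring.
Qed.

Lemma digits_value_gt0 ds : ds != [::] -> head 1 ds != 0 -> 0 < digits_value ds.
Proof.
case: ds => // d ds _ /= d0; rewrite digits_value_cons.
by rewrite addn_gt0 muln_gt0 lt0n d0 expn_gt0.
Qed.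

(** The default value 1 of [head] lets the empty sequence through, which makes
    the hypothesis stable under removal of the last digit; zero is then
    represented by the empty sequence only. *)
Lemma digits_value_inj ds es :
    all (fun d => d < 10) ds -> all (fun d => d < 10) es ->
    head 1 ds != 0 -> head 1 es != 0 ->
  digits_value ds = digits_value es -> ds = es.
Proof.
have nil0 : digits_value [::] = 0 by rewrite /digits_value big_ord0.
have rcons0 s x : rcons s x != [::] by case: s.
have hd s x : head 1 (rcons s x) != 0 -> head 1 s != 0 by case: s.
elim/last_ind: ds es => [|ds d IH] es; case/lastP: es => [|es e] //.
- by move=> _ _ _ /(digits_value_gt0 (rcons0 _ _ _)) + E; rewrite -E nil0.
- by move=> _ _ /(digits_value_gt0 (rcons0 _ _ _)) + _ E; rewrite E nil0.
rewrite !all_rcons => /andP[d10 dsP] /andP[e10 esP] /hd hds /hd hes.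
rewrite !digits_value_rcons => E.
have -> : d = e by lia.
by rewrite (IH es) //; lia.
Qed.

Definition repunit (n : nat) : nat := (10 ^ n - 1) %/ 9.

Lemma repunitE n : 9 * repunit n + 1 = 10 ^ n.
Proof.
suff [q E] : exists q, 10 ^ n = 9 * q + 1 by rewrite /repunit E; lia.
elim: n => [|n [q IH]]; first by exists 0.
by exists (10 * q + 1); rewrite expnS IH; lia.
Qed.

Lemma digits_value_nseq n a : digits_value (nseq n a) = a * repunit n.
Proof.
elim: n => [|n IH]; first by rewrite /digits_value big_ord0 muln0.
have := repunitE n; have := repunitE n.+1.
rewrite -[nseq _ _]/(a :: nseq n a) digits_value_cons IH size_nseq expnS.
by nia.
Qed.

Lemma repdigit_digits ds a n :
    1 <= a <= 9 -> 1 <= n -> decimal_rep (a * repunit n) ds ->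
  ds = nseq n a.
Proof.
move=> a9 n1 [dsP hds E]; apply: digits_value_inj => //.
- by rewrite all_nseq; lia.
- by case: ds hds {dsP E}.
- by case: n n1 {E} => //= n _; lia.
by rewrite digits_value_nseq.
Qed.

(** * The sum-of-the-last-n sequence started by ones *)

Section Nbonacci.

Variables (n : nat) (F : nat -> nat).
Hypothesis n2 : 2 <= n.
Hypothesis FK : keith_seq (nseq n 1) F.

Lemma nbonacci_init i : 1 <= i <= n -> F i = 1.
Proof.
case: i => // i /= ilt; case: FK; rewrite size_nseq => -> // _.
by rewrite nth_nseq ilt.
Qed.

Lemma nbonacci_sum m : n < m -> F m = \sum_(1 <= i < n.+1) F (m - i).
Proof. by case: FK; rewrite size_nseq => _; apply. Qed.

Lemma nbonacci_first : F n.+1 = n.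
Proof.
rewrite nbonacci_sum // (eq_big_nat _ _ (F2 := fun=> 1)).
  by rewrite sum_nat_const_nat; lia.
by move=> i ?; apply: nbonacci_init; lia.
Qed.

(** Comparing the sums that define two consecutive terms removes the dependence
    of the number of summands on [n]. *)
Lemma nbonacci_rec m : 0 < m -> F (m + n).+1 + F m = 2 * F (m + n).
Proof.
move=> m0; rewrite nbonacci_sum; last by lia.
rewrite big_ltn; last by lia.
rewrite subn1 /= mul2n -addnn -addnA; congr (_ + _).
rewrite [RHS]nbonacci_sum; last by lia.
rewrite [RHS]big_nat_recr /=; last by lia.
rewrite addnK; congr (_ + _).
by rewrite big_add1 /=; apply: eq_big_nat => i _; congr F; lia.
Qed.

Lemma nbonacci_le m : 0 < m -> F m <= F m.+1.
Proof.
move=> m0; case: (ltnP m n) => mn; first by rewrite !nbonacci_init //; lia.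
rewrite [leqRHS]nbonacci_sum // big_ltn; last by lia.
by rewrite subn1 leq_addr.
Qed.

Lemma nbonacci_mono m p : 0 < m -> m <= p -> F m <= F p.
Proof.
move=> m0 /subnKC <-; elim: (p - m) => [|k IH]; first by rewrite addn0.
by rewrite addnS (leq_trans IH) // nbonacci_le //; lia.
Qed.

(** By the three-term recurrence this amounts to F (m - n) being at most half of
    F m, which holds because the sum defining F m contains, as n >= 2, both
    F (m - n) and the no smaller F (m - 1). *)
Lemma nbonacci_ratio m : n < m -> 3 * F m <= 2 * F m.+1.
Proof.
move=> nm; have [k k0 ->] : exists2 k, 0 < k & m = k + n by exists (m - n); lia.
have := nbonacci_rec k0.
suff : 2 * F k <= F (k + n) by lia.
have Fk : F k <= F (k + n).-1 by apply: nbonacci_mono => //; lia.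
rewrite [leqRHS]nbonacci_sum; last by lia.
rewrite big_ltn; last by lia.
rewrite big_nat_recr /=; last by lia.
by rewrite addnK subn1; lia.
Qed.

Lemma nbonacci_growth s : 3 ^ s <= 2 ^ s * F (n.+1 + s).
Proof.
elim: s => [|s IH]; first by rewrite addn0 nbonacci_first; lia.
have nm : n < n.+1 + s by lia.
rewrite addnS !expnS (@leq_trans (2 ^ s * (3 * F (n.+1 + s)))) //.
  by rewrite mulnCA leq_pmul2l.
by rewrite [2 * 2 ^ s]mulnC -mulnA leq_pmul2l ?expn_gt0 ?nbonacci_ratio.
Qed.

(** The growth rate 3/2 gives this range because (3/2)^6 > 10. *)
Lemma nbonacci_large m : 7 * n.+1 <= m -> 10 ^ n < F m.
Proof.
move=> mn; apply: leq_trans (nbonacci_mono _ mn); last by [].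
have := nbonacci_growth (6 * n.+1).
rewrite (_ : n.+1 + _ = 7 * n.+1); last by lia.
move=> H.
have p64 : 0 < 2 ^ (6 * n.+1) by rewrite expn_gt0.
rewrite -(ltn_pmul2l p64); apply: leq_trans H.
rewrite !expnM (_ : 2 ^ 6 = 64) // (_ : 3 ^ 6 = 729) //.
(* (3/2)^6 = 729/64 > 640/64 = 10 *)
rewrite (@leq_trans (640 ^ n.+1)) //; last by rewrite leq_exp2r.
rewrite (_ : 640 = 64 * 10) // expnMn ltn_pmul2l ?expn_gt0 //.
by rewrite ltn_exp2l.
Qed.

(** * Powers of 2 in the shifted sequence *)

Local Open Scope ring_scope.

(** Subtracting the constant solution 1 of the three-term recurrence leaves a
    solution with n consecutive zeros; the value at 0 is the one obtained by
    running the recurrence backwards, so that blocks of length n+1 start at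
    multiples of n+1. *)
Definition shifted (m : nat) : int :=
  if m == 0%N then 1 - n%:Z else (F m)%:Z - 1.

Lemma shifted_init i : (1 <= i <= n)%N -> shifted i = 0.
Proof. by move=> ni; rewrite /shifted nbonacci_init // gtn_eqF //; lia. Qed.

Lemma shifted_rec m : shifted (m + n).+1 = 2 * shifted (m + n) - shifted m.
Proof.
case: m => [|m].
  by rewrite add0n (@shifted_init n) /shifted /= ?nbonacci_first; lia.
by rewrite /shifted /=; have := @nbonacci_rec m.+1 isT; lia.
Qed.

Lemma shifted_rec_block j i :
  shifted (j.+1 * n.+1 + i.+1) =
  2 * shifted (j.+1 * n.+1 + i) - shifted (j * n.+1 + i.+1).
Proof.
have := shifted_rec (j * n.+1 + i.+1).
rewrite (_ : (_ + n).+1 = (j.+1 * n.+1 + i.+1))%N; last by lia.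
by rewrite (_ : (_ + i.+1 + n) = (j.+1 * n.+1 + i))%N; last by lia.
Qed.

(** Within a block each step doubles the previous term and subtracts the term
    in the same position of the preceding block, which has the required power
    of 2 by induction. *)
Lemma dvdz_shifted j i : (i <= n)%N -> (2 ^+ i %| shifted (j * n.+1 + i))%Z.
Proof.
elim: j i => [|j IHj]; case=> [|i] ilen; rewrite ?expr0 ?dvd1z //.
  by rewrite mul0n add0n shifted_init ?dvdz0 //; lia.
elim: i ilen => [|i IHi] ilen; rewrite shifted_rec_block rpredB //.
- by rewrite expr1 dvdz_mulr.
- exact: (IHj 1%N).
- by rewrite exprS dvdz_mul // IHi //; lia.
- exact: IHj.
Qed.

(** A block ends with a multiple of 2^n, whose double disappears: passing to the
    next block only changes the sign of the first term. *)
Lemma shifted_block0 j :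
  (2 ^+ n.+1 %| shifted (j * n.+1) - (-1) ^+ j * (1 - n%:Z))%Z.
Proof.
elim: j => [|j IHj]; first by rewrite mul0n expr0 mul1r subrr dvdz0.
have := shifted_rec (j * n.+1).
rewrite (_ : (_ + n).+1 = (j.+1 * n.+1))%N; last by lia.
move=> ->.
rewrite (_ : _ - _ = 2 * shifted (j * n.+1 + n) -
   (shifted (j * n.+1) - (-1) ^+ j * (1 - n%:Z))); last by rewrite exprS; ring.
by rewrite rpredB // exprS dvdz_mul // dvdz_shifted.
Qed.

Lemma shifted_block1 j :
  (2 ^+ n.+1 %| shifted (j * n.+1 + 1) - (-1) ^+ j * (2 * j%:Z * (1 - n%:Z)))%Z.
Proof.
elim: j => [|j IHj].
  by rewrite shifted_init ?mulr0 ?mul0r ?mulr0 ?subrr ?dvdz0 //; lia.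
rewrite shifted_rec_block addn0.
rewrite (_ : _ - _ = 2 * (shifted (j.+1 * n.+1) - (-1) ^+ j.+1 * (1 - n%:Z)) -
  (shifted (j * n.+1 + 1) - (-1) ^+ j * (2 * j%:Z * (1 - n%:Z)))).
  by rewrite rpredB // dvdz_mull // shifted_block0.
by rewrite exprS intS; ring.
Qed.

(** * Congruences forced by a repunit *)

Lemma shifted_repunit m :
  (0 < m)%N -> F m = repunit n -> 9 * shifted m + 10 = 10 ^+ n.
Proof.
move=> m0 E; rewrite /shifted gtn_eqF // E.
have -> : 10 ^+ n = (10 ^ n)%N :> int by rewrite -natrX natz.
by rewrite -repunitE; lia.
Qed.

(** Otherwise 4 divides the shifted term as well as 10^n, hence divides 10. *)
Lemma repunit_offset m :
  (0 < m)%N -> F m = repunit n -> (m %% n.+1 <= 1)%N.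
Proof.
move=> m0 E; rewrite leqNgt; apply/negP => i2.
have mn : (m %% n.+1 <= n)%N by rewrite -ltnS ltn_pmod.
have := dvdz_shifted (m %/ n.+1) mn; rewrite -divn_eq => Hm.
have two_dvd : (2 ^+ 2 %| shifted m)%Z
  by apply: dvdz_trans Hm; apply: dvdz_exp2l.
have : (2 ^+ 2 %| 10 ^+ n)%Z.
  by rewrite (dvdz_trans (dvdz_exp2l _ n2)) // dvdz_exp2r.
by rewrite -(shifted_repunit m0 E) rpredDl // dvdz_mull.
Qed.

Lemma repunit_offset0 j :
    (0 < j)%N -> F (j * n.+1) = repunit n ->
  (2 ^+ n %| 10 + (-1) ^+ j * 9 * (1 - n%:Z))%Z.
Proof.
move=> j0 E.
have -> : 10 + (-1) ^+ j * 9 * (1 - n%:Z) = 10 ^+ n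
    - 9 * (shifted (j * n.+1) - (-1) ^+ j * (1 - n%:Z)).
  by rewrite -(shifted_repunit _ E) ?muln_gt0 ?j0 //; ring.
rewrite rpredB ?dvdz_exp2r // dvdz_mull //.
by apply: dvdz_trans (shifted_block0 j); apply: dvdz_exp2l.
Qed.

Lemma repunit_offset1 j :
    F (j * n.+1 + 1) = repunit n ->
  (2 ^+ n.-1 %| 5 + (-1) ^+ j * 9 * j%:Z * (1 - n%:Z))%Z.
Proof.
move=> E; rewrite -(@dvdz_mul2l 2) // -exprS prednK; last by lia.
have -> : 2 * (5 + (-1) ^+ j * 9 * j%:Z * (1 - n%:Z)) = 10 ^+ n
    - 9 * (shifted (j * n.+1 + 1) - (-1) ^+ j * (2 * j%:Z * (1 - n%:Z))).
  by rewrite -(shifted_repunit _ E) ?addn_gt0 ?orbT //; ring.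
rewrite rpredB ?dvdz_exp2r // dvdz_mull //.
by apply: dvdz_trans (shifted_block1 j); apply: dvdz_exp2l.
Qed.

End Nbonacci.

(** * Excluding the remaining cases *)

(** The left-hand side bounds the numbers in the two congruences below when
    j <= 6. *)
Lemma pow2_gt k : 9 <= k -> 54 * k + 5 < 2 ^ k.
Proof.
move=> k9; rewrite -(subnK k9); elim: (k - 9) => [//|d IH].
by rewrite addSn expnS; lia.
Qed.

Lemma ndvdz_pow2 k (z : int) : 0 < `|z|%N < 2 ^ k -> ~~ (2 ^+ k %| z)%Z.
Proof. by move=> /andP[z0 zk]; rewrite dvdzE abszX gtnNdvd. Qed.

Local Open Scope ring_scope.

(** The exception is genuine: for n = 3 and j even, 10 - 9 * 2 = -8 is
    divisible by 8. *)
Lemma offset0_excluded n j :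
    (2 <= n)%N -> (j < 7)%N ->
    (2 ^+ n %| 10 + (-1) ^+ j * 9 * (1 - n%:Z))%Z ->
  n = 3%N /\ ~~ odd j.
Proof.
move=> n2 j7; case: (ltnP n 10) => [n10|/ltnW/pow2_gt n10].
  by move: n n2 n10 j j7; do 10?[case=> //]; move=> _ _; do 7?[case=> //].
rewrite (negbTE (ndvdz_pow2 _)) //.
by rewrite -signr_odd; case: (odd j); rewrite ?expr0 ?expr1; lia.
Qed.

(** The power 2^(n-1) is only 2 for n = 2, which leaves every odd j; the pair
    n = 4, j = 1 survives because 5 + 27 = 32 is a multiple of 8. *)
Lemma offset1_excluded n j :
    (2 <= n)%N -> (j < 7)%N ->
    (2 ^+ n.-1 %| 5 + (-1) ^+ j * 9 * j%:Z * (1 - n%:Z))%Z ->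
  (n = 2%N /\ odd j) \/ (n = 4%N /\ j = 1%N).
Proof.
move=> n2 j7; case: (ltnP n 10) => [n10|n10]; last first.
  case: n n2 n10 => // k _ /pow2_gt k9 /=.
  (* j = 0 leaves 5, which is smaller than any 2^k with k >= 9 *)
  rewrite (negbTE (ndvdz_pow2 _)) // -signr_odd.
  case: (ltnP 0 j) => [j0|]; last by rewrite leqn0 => /eqP ->; lia.
  by case: (odd j); rewrite ?expr0 ?expr1; nia.
move: n n2 n10 j j7; do 10?[case=> //]; move=> _ _; do 7?[case=> //].
all: by move=> _ _; by [left | right].
Qed.

Local Close Scope ring_scope.

Lemma nbonacci_2_values F : keith_seq (nseq 2 1) F -> F 4 = 3 /\ F 7 = 13.
Proof.
move=> FK; have rec := nbonacci_rec (isT : 1 < 2) FK.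
have := nbonacci_first (isT : 1 < 2) FK.
have init := nbonacci_init FK.
have := init 1 isT.
have := init 2 isT.
have : F 4 + F 1 = 2 * F 3 := rec 1 isT.
have : F 5 + F 2 = 2 * F 4 := rec 2 isT.
have : F 6 + F 3 = 2 * F 5 := rec 3 isT.
have : F 7 + F 4 = 2 * F 6 := rec 4 isT.
lia.
Qed.

Lemma nbonacci_3_values F : keith_seq (nseq 3 1) F -> F 8 = 31 /\ F 11 = 193.
Proof.
move=> FK; have rec := nbonacci_rec (isT : 1 < 3) FK.
have := nbonacci_first (isT : 1 < 3) FK.
have init := nbonacci_init FK.
have := init 1 isT.
have := init 2 isT.
have := init 3 isT.
have : F 5 + F 1 = 2 * F 4 := rec 1 isT.
have : F 6 + F 2 = 2 * F 5 := rec 2 isT.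
have : F 7 + F 3 = 2 * F 6 := rec 3 isT.
have : F 8 + F 4 = 2 * F 7 := rec 4 isT.
have : F 9 + F 5 = 2 * F 8 := rec 5 isT.
have : F 10 + F 6 = 2 * F 9 := rec 6 isT.
have : F 11 + F 7 = 2 * F 10 := rec 7 isT.
lia.
Qed.

Lemma nbonacci_4_values F : keith_seq (nseq 4 1) F -> F 6 = 7.
Proof.
move=> FK; have rec := nbonacci_rec (isT : 1 < 4) FK.
have := nbonacci_first (isT : 1 < 4) FK.
have init := nbonacci_init FK.
have := init 1 isT.
have := init 2 isT.
have := init 3 isT.
have := init 4 isT.
have : F 6 + F 1 = 2 * F 5 := rec 1 isT.
lia.
Qed.

(** In the surviving cases with n = 2 and n = 3 the term at the smallest possible
    index lies below the repunit, and by monotonicity those at all the other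
    possible indices lie above it. *)
Lemma nbonacci_neq_repunit n F m :
  2 <= n -> keith_seq (nseq n 1) F -> 0 < m -> F m <> repunit n.
Proof.
move=> n2 FK m0 E; have j7 : m %/ n.+1 < 7.
  rewrite ltn_divLR // ltnNge; apply/negP => /(nbonacci_large n2 FK).
  by rewrite E -repunitE; lia.
have i1 := repunit_offset n2 FK m0 E.
have defm := divn_eq m n.+1.
move: j7 i1 defm; set j := m %/ n.+1; set i := m %% n.+1 => j7 i1 defm.
have [i0 | {}i1] : i = 0 \/ i = 1 by lia.
  rewrite i0 addn0 in defm.
  have j0 : 0 < j by case: (j) defm m0 => // ->.
  rewrite defm in E; have := repunit_offset0 n2 FK j0 E.
  case/(offset0_excluded n2 j7) => n3 jeven; subst n.
  have [F8 F11] := nbonacci_3_values FK.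
  have j2 : j = 2 \/ 11 <= j * 4 by lia.
  case: j2 => [j2 | /(nbonacci_mono n2 FK (ltn0Sn _))].
    by move: E; rewrite j2 F8.
  by rewrite E F11.
rewrite i1 in defm; rewrite defm in E; have := repunit_offset1 n2 FK E.
case/(offset1_excluded n2 j7) => [[n2' jodd] | [n4 j1]]; subst n.
  have [F4 F7] := nbonacci_2_values FK.
  have j3 : j = 1 \/ 7 <= j * 3 + 1 by lia.
  case: j3 => [j1 | /(nbonacci_mono n2 FK (ltn0Sn _))].
    by move: E; rewrite j1 F4.
  by rewrite E F7.
by move: E; rewrite j1 (nbonacci_4_values FK).
Qed.

(** * Reduction of rep-digits to repunits *)

Lemma keith_seq_scale a n K :
    0 < a -> keith_seq (nseq n a) K ->
  exists2 F, keith_seq (nseq n 1) F & forall m, 0 < m -> K m = a * F m.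
Proof.
move=> a0 []; rewrite size_nseq => Kinit Krec.
have aK m : 0 < m -> a %| K m.
  elim/ltn_ind: m => [[//|m]] IH _; case: (ltnP m n) => [mn | nm].
    by rewrite Kinit // nth_nseq mn.
  rewrite Krec // big_seq_cond; apply: dvdn_sum => i.
  by rewrite mem_index_iota => /andP[ilt _]; apply: IH; lia.
have KE m : 0 < m -> K m = a * (K m %/ a) by move=> /aK /divnK; lia.
exists (fun m => K m %/ a); last exact: KE.
split=> [i|m]; rewrite size_nseq => H.
  by rewrite Kinit // !nth_nseq H divnn a0.
apply/eqP; rewrite -(eqn_pmul2l a0) -KE; last by lia.
rewrite Krec // big_distrr /=; apply/eqP; apply: eq_big_nat => i ilt.
by rewrite -KE //; lia.
Qed.

Lemma no_keith_repdigit N : ~ (keith N /\ repdigit N).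
Proof.
move=> [[ds [K [dsN KK n2 [m [m1 NK]]]]] [a [n [a9 n1 Na]]]].
move: dsN; rewrite Na => /(repdigit_digits a9 n1) dsE; subst ds.
rewrite size_nseq in n2.
have a0 : 0 < a by case/andP: a9.
have [F FK KE] := keith_seq_scale a0 KK.
apply: (nbonacci_neq_repunit n2 FK m1); apply/eqP.
by rewrite -(eqn_pmul2l a0) -KE // -NK Na.
Qed.

Theorem theorem1 :
  finitely_many (fun N => keith N /\ repdigit N) *
  effectively_determined (fun N => keith N /\ repdigit N).
Proof.
split; first by exists [::] => N /no_keith_repdigit.
split; first by exists 0 => N /no_keith_repdigit.
by exists [::] => N; split=> [//|/no_keith_repdigit].
Qed.
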